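(* Let $A\subseteq\mathbb{R}^2$ be a compact set such that $\mathbb{R}^2=A+\mathbb{Z}^2$, and let $l_1,l_2$ be two one-dimensional linear subspaces of $\mathbb{R}^2$. Then $(A-A)\cap\mathbb{Z}^2\not\subseteq l_1\cup l_2$.
   Context: For sets $A,B\subseteq\mathbb{R}^2$, $A\pm B=\{a\pm b:a\in A,\ b\in B\}$. *)

(* Defs.v *)
From mathcomp Require Import all_boot all_order all_algebra.
From mathcomp Require Import all_classical all_reals all_analysis.
Set Implicit Arguments.
Unset Strict Implicit.
Unset Printing Implicit Defensive.
Import Order.TTheory GRing.Theory Num.Theory.
Import numFieldNormedType.Exports.
Local Open Scope classical_set_scope.
Local Open Scope ring_scope.

Definition setadd (V : zmodType) (A B : set V) : set V :=
  [set a + b | a in A & b in B].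

Definition setsub (V : zmodType) (A B : set V) : set V :=
  [set a - b | a in A & b in B].

Definition Z2 (R : realType) : set 'rV[R]_2 :=
  [set v : 'rV[R]_2 | forall j, v 0 j \is a Num.int].
Arguments Z2 : clear implicits.

(* Main.v *)
Require Import Defs.
From mathcomp Require Import all_boot all_order all_algebra.
From mathcomp Require Import all_classical all_reals all_analysis.
From mathcomp Require Import zify ring lra.
Set Implicit Arguments.
Unset Strict Implicit.
Unset Printing Implicit Defensive.
Import Order.TTheory GRing.Theory Num.Theory.
Import numFieldNormedType.Exports.
Local Open Scope classical_set_scope.
Local Open Scope ring_scope.

(** Suppose [(A - A) ∩ Z^2] lies in [l1 ∪ l2]. By compactness this persists for
    integer points at distance at most [1/n] from [A - A], for some [n]. Choose a
    [Z^2]-equivariant map [f] from the grid [(1/n)Z^2] to [Z^2] with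
    [x - f x] in [A]; on neighbouring grid points the values of [f] differ by an
    element of [l1 ∪ l2]. Among the three side vectors of a triangle of [f]-values,
    two lie in the same line, hence all three do, and the triangle is degenerate.
    But [f] induces a map of degree one of the torus: the signed areas of the
    triangles over a fundamental domain add up to 1. *)

Definition vec2 (R : nzRingType) (a b : R) : 'rV[R]_2 :=
  \row_j (if j == 0 then a else b).

Definition cross (R : nzRingType) (u v : 'rV[R]_2) : R :=
  u 0 0 * v 0 1 - u 0 1 * v 0 0.

(** Discrete Green formula. Each summand is twice the signed area of the image of a grid cell, cut
    along its diagonal, and equals a sum of edge terms around the cell. Interior edges cancel;
    opposite boundary edges differ by a unit translation, so what remains are coordinate increments,
    which telescope to 1 in each direction. *)
Lemma sum_cross_equivariant (R : comNzRingType) (n : nat)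
    (f : nat -> nat -> 'rV[R]_2) :
  (forall j, f n j = f 0%N j + vec2 1 0) ->
  (forall i, f i n = f i 0%N + vec2 0 1) ->
  \sum_(0 <= i < n) \sum_(0 <= j < n)
    (cross (f i.+1 j - f i j) (f i.+1 j.+1 - f i j) +
     cross (f i.+1 j.+1 - f i j) (f i j.+1 - f i j)) = 2.
Proof.
move=> fE1 fE2.
pose H i j := cross (f i j) (f i.+1 j); pose V i j := cross (f i j) (f i j.+1).
have areaE i j : cross (f i.+1 j - f i j) (f i.+1 j.+1 - f i j) +
    cross (f i.+1 j.+1 - f i j) (f i j.+1 - f i j) =
    (V i.+1 j - V i j) - (H i j.+1 - H i j).
  by rewrite /H /V /cross !mxE; ring.
under eq_bigr => i _ do under eq_bigr => j _ do rewrite areaE.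
under eq_bigr => i _ do rewrite sumrB telescope_sumr//.
rewrite sumrB exchange_big /=.
under eq_bigr => j _ do rewrite telescope_sumr//.
have VE j : V n j - V 0%N j = f 0%N j.+1 0 1 - f 0%N j 0 1.
  by rewrite /V /cross !fE1 !mxE /=; ring.
have HE i : H i n - H i 0%N = f i 0%N 0 0 - f i.+1 0%N 0 0.
  by rewrite /H /cross !fE2 !mxE /=; ring.
under eq_bigr => j _ do rewrite VE.
under [X in _ - X]eq_bigr => i _ do rewrite HE -opprB.
rewrite sumrN !telescope_sumr// fE1 fE2 !mxE /=; ring.
Qed.

Lemma cross_dim1 (R : fieldType) (l : {vspace 'rV[R]_2}) (u v : 'rV[R]_2) :
  \dim l = 1%N -> u \in l -> v \in l -> cross u v = 0.
Proof.
move=> dim_l.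
have l_neq0 : vpick l != 0 by rewrite vpick0 -dimv_eq0 dim_l.
have -> : l = <[vpick l]>%VS.
  apply/eqP; rewrite eq_sym eqEdim dim_vline l_neq0 dim_l leqnn andbT.
  by rewrite -memvE memv_pick.
move=> /vlineP[a ->] /vlineP[b ->]; rewrite /cross !mxE; ring.
Qed.

Lemma cross_two_lines (R : fieldType) (l1 l2 : {vspace 'rV[R]_2})
    (u v : 'rV[R]_2) :
  \dim l1 = 1%N -> \dim l2 = 1%N ->
  (u \in l1) || (u \in l2) -> (v \in l1) || (v \in l2) ->
  (v - u \in l1) || (v - u \in l2) -> cross u v = 0.
Proof.
move=> d1 d2.
(* Up to sign, [cross] takes the same value on every pair of sides of the triangle, so any pair
   sharing a line will do. *)
have crossBr : cross u (v - u) = cross u v by rewrite /cross !mxE; ring.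
have crossBl : cross (v - u) v = - cross u v by rewrite /cross !mxE; ring.
move=> /orP[] ul /orP[] vl /orP[] wl;
  by [exact: cross_dim1 ul vl | exact: cross_dim1 ul vl
     | rewrite -crossBr; exact: cross_dim1 ul wl
     | apply: oppr_inj; rewrite oppr0 -crossBl; exact: cross_dim1 wl vl].
Qed.

Lemma int_gap (R : realType) (r : R) : exists2 e : R, 0 < e &
  forall m, m \is a Num.int -> `|r - m| < e -> m = r.
Proof.
have /andP[] := floor_itv r; set k := Num.floor r => kr rk.
have [rE|r_neq] := eqVneq k%:~R r.
  exists 1 => // _ /intrP[m ->]; rewrite -rE -intrB -intr_norm ltrz1 => h.
  by congr (_%:~R); lia.
have {kr r_neq} kr : k%:~R < r by rewrite lt_neqAle r_neq.
(* For [r] strictly between two consecutive integers, no integer is this close and the claim is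
   vacuous. *)
exists (Num.min (r - k%:~R) ((k + 1)%:~R - r)).
  by rewrite lt_min !subr_gt0 kr rk.
move=> _ /intrP[m ->]; rewrite lt_min !ltr_norml => /andP[/andP[_ h1] /andP[h2 _]].
have : (k < m)%R by rewrite -(ltr_int R); lra.
have : (m < k + 1)%R by rewrite -(ltr_int R); lra.
lia.
Qed.

Lemma Z2_gap (R : realType) (x : 'rV[R]_2) : exists2 e : R, 0 < e &
  forall z, Z2 R z -> (forall j, `|x 0 j - z 0 j| < e) -> z = x.
Proof.
have [e0 e0_gt0 gap0] := int_gap (x 0 0).
have [e1 e1_gt0 gap1] := int_gap (x 0 1).
exists (Num.min e0 e1) => [|z zZ xz]; first by rewrite lt_min e0_gt0.
apply/rowP => j; have := xz j; rewrite lt_min => /andP[].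
case: j => -[|[|//]] jP.
  by rewrite (_ : Ordinal jP = 0) => [h _|]; [exact: gap0|exact: val_inj].
by rewrite (_ : Ordinal jP = 1) => [_ h|]; [exact: gap1|exact: val_inj].
Qed.

(** Around each [x] in [K] there is a radius [e] within which the only possible integer point is [x]
    itself. If [y] is within [e / 2] of [x] and [u] is smaller than [e / 2], an integer point
    [y + u] must then be [x], which lies in [L]. Compactness makes the bound on [u] uniform. *)
Lemma compact_Z2_thickening (R : realType) (K L : set 'rV[R]_2) :
  compact K -> K `&` Z2 R `<=` L ->
  exists n : nat, forall x u : 'rV[R]_2, K x -> (forall j, `|u 0 j| <= n.+1%:R^-1) ->
    Z2 R (x + u) -> L (x + u).
Proof.
move=> /compact_near_coveringP Kcov KL.
pose P (n : nat) (x : 'rV[R]_2) := forall u : 'rV[R]_2,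
  (forall j, `|u 0 j| <= n.+1%:R^-1) -> Z2 R (x + u) -> L (x + u).
have [] := Kcov nat \oo P _; last first.
  by move=> n _ /(_ n (leqnn n)) KP; exists n => x u Kx; exact: KP.
move=> x Kx; have [e e_gt0 xgap] := Z2_gap x.
have e2_gt0 : 0 < e / 2 by rewrite divr_gt0.
exists (ball x (e / 2), [set n | n.+1%:R^-1 < e / 2]).
  split; first exact: nbhsx_ballx.
  exact: near_infty_natSinv_lt (PosNum e2_gt0).
move=> [y n] /= [[_ xy] ne] u un yuZ.
have yux : y + u = x.
  apply: xgap => // j; have := xy 0 j; have := le_lt_trans (un j) ne.
  rewrite /ball /= mxE !ltr_norml => /andP[? ?] /andP[? ?].
  by apply/andP; split; lra.
by rewrite yux; apply: KL; split => //; rewrite -yux.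
Qed.

Lemma compact_setsub (R : realType) (A : set 'rV[R]_2) :
  compact A -> compact (setsub A A).
Proof.
move=> cA.
have -> : setsub A A = (fun p : 'rV[R]_2 * 'rV[R]_2 => p.1 - p.2) @` (A `*` A).
  apply/seteqP; split => [_ [a Aa [b Ab <-]]|_ [[a b] [Aa Ab] <-]].
    by exists (a, b).
  by exists a => //; exists b.
apply: continuous_compact; last exact: compact_setX.
apply: continuous_subspaceT; exact: sub_continuous.
Qed.

Theorem theorem2 (R : realType) (A : set 'rV[R]_2)
    (l1 l2 : {vspace 'rV[R]_2})
    (Acompact : compact A)
    (Acover : [set: 'rV[R]_2] = setadd A (Z2 R))
    (dim_l1 : \dim l1 = 1%N) (dim_l2 : \dim l2 = 1%N) :
  ~ (setsub A A `&` Z2 R `<=` [set` l1] `|` [set` l2]).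
Proof.
move=> /(compact_Z2_thickening (compact_setsub Acompact))[N thick].
set n := N.+1 in thick.
have /choice[g gP] (x : 'rV[R]_2) : exists z, Z2 R z /\ A (x - z).
  have : setadd A (Z2 R) x by rewrite -Acover.
  by move=> [a Aa [z zZ <-]]; exists z; split=> //; rewrite addrK.
(* Euclidean division by [n] splits a grid coordinate into its integer part [q] and fractional part
   [r]. Applying [g] to fractional parts only makes [f] equivariant, however irregular [g] is. *)
pose q (i : nat) : R := (i %/ n)%:R.
pose r (i : nat) : R := (i %% n)%:R / n%:R.
pose f i j := g (vec2 (r i) (r j)) + vec2 (q i) (q j).
pose x i j : 'rV[R]_2 := vec2 (i%:R / n%:R) (j%:R / n%:R).
have n_neq0 : n%:R != 0 :> R by rewrite pnatr_eq0.
have rqE i : i%:R / n%:R = r i + q i.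
  by rewrite /r /q {1}(divn_eq i n) natrD natrM mulrDl mulfK// addrC.
have fZ i j : Z2 R (f i j).
  move=> k; rewrite !mxE rpredD//; first exact: (gP _).1.
  by case: ifP => _; rewrite rpred_nat.
have fA i j : A (x i j - f i j).
  rewrite (_ : _ - _ = vec2 (r i) (r j) - g (vec2 (r i) (r j))); first exact: (gP _).2.
  by apply/rowP => k; rewrite !mxE !rqE; case: ifP => _; ring.
have fn1 j : f n j = f 0%N j + vec2 1 0.
  rewrite /f /r /q modnn mod0n divnn div0n -addrA; congr (_ + _).
  by apply/rowP => k; rewrite !mxE; case: ifP => _; rewrite ?add0r ?addr0.
have fn2 i : f i n = f i 0%N + vec2 0 1.
  rewrite /f /r /q modnn mod0n divnn div0n -addrA; congr (_ + _).
  by apply/rowP => k; rewrite !mxE; case: ifP => _; rewrite ?add0r ?addr0.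
(* Here [(i, j)] and [(a, b)] are any two corners of the cell at [(i', j')], diagonal ones
   included. *)
have fL i j a b i' j' : (i' <= i <= i'.+1)%N -> (j' <= j <= j'.+1)%N ->
   (i' <= a <= i'.+1)%N -> (j' <= b <= j'.+1)%N ->
   (f i j - f a b \in l1) || (f i j - f a b \in l2).
  move=> hi hj ha hb.
  have near1 (k c m : nat) : (m <= k <= m.+1)%N -> (m <= c <= m.+1)%N ->
      `|k%:R / n%:R - c%:R / n%:R| <= n%:R^-1 :> R.
    move=> /andP[mk km] /andP[mc cm].
    rewrite -mulrBl normrM (ger0_norm (_ : 0 <= n%:R^-1)) ?invr_ge0//.
    rewrite ler_piMl ?invr_ge0// ler_norml.
    move: mk km mc cm; rewrite -!(ler_nat R) -!natr1 => *.
    by apply/andP; split; lra.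
  pose u := x i j - x a b.
  (* An element of [A - A] moved by a grid step [u] with coordinates at most [1/n] in absolute
     value, as [thick] requires. *)
  have fE : f i j - f a b = ((x a b - f a b) - (x i j - f i j)) + u.
    by apply/rowP => k; rewrite /u !mxE; ring.
  have : ([set` l1] `|` [set` l2]) (f i j - f a b).
    rewrite fE; apply: thick.
    - by exists (x a b - f a b); [exact: fA|exists (x i j - f i j); [exact: fA|]].
    - by move=> k; rewrite !mxE; case: ifP => _; [exact: near1 hi ha|exact: near1 hj hb].
    - by rewrite -fE => k; rewrite !mxE rpredB//; [have := fZ i j k|have := fZ a b k];
        rewrite !mxE.
  by move=> [] h; apply/orP; [left|right].
have := sum_cross_equivariant fn1 fn2.
(* If every triangle is degenerate, the sum is both 0 and 2. *)
rewrite big1_seq => [|i _]; first by move/esym/eqP; rewrite pnatr_eq0.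
rewrite big1_seq// => j _.
have subBB (a b c : 'rV[R]_2) : (a - c) - (b - c) = a - b.
  by rewrite opprB addrA subrK.
by rewrite !(cross_two_lines dim_l1 dim_l2) ?addr0 ?subBB //;
  apply: (@fL _ _ _ _ i j); rewrite ?leqnn ?leqnSn.
Qed.
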